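(* Let $1<p<\infty$ be fixed and let $(\lambda_n)_{n\ge 1}$ be a sequence of real numbers with $\lambda_n>0$ for all $n\geq 1$. Put $\Lambda_n=\sum_{i=1}^n\lambda_i$, and let $A=(a_{n,k})_{n,k\ge 1}$ be the weighted mean matrix given by $a_{n,k}=\lambda_k/\Lambda_n$ for $1\le k\le n$ and $a_{n,k}=0$ for $k>n$. Suppose there exists a constant $L$ with $0<L<p$ such that for every integer $n\ge 1$, $$\frac{\Lambda_{n+1}}{\lambda_{n+1}}-\frac{\Lambda_n}{\lambda_n}\le L+\Big(\frac{\lambda_n}{2\Lambda_n}\Big)\Big(1-\frac1p\Big)L^2.$$ Then $\|A\|_{p,p}\le \dfrac{p}{p-L}$.
   Context: For $p\ge 1$, $l^p$ is the Banach space of complex sequences $\mathbf{a}=(a_n)_{n\ge1}$ with norm $\|\mathbf{a}\|_p=\big(\sum_{n=1}^\infty |a_n|^p\big)^{1/p}<\infty$. For an infinite matrix $C=(c_{n,k})$, $C\cdot\mathbf{a}$ is the sequence with $n$-th term $\sum_{k} c_{n,k}a_k$, and $\|C\|_{p,p}=\sup_{\|\mathbf{a}\|_p\le 1}\|C\cdot\mathbf{a}\|_p$. Thus $\|A\|_{p,p}\le U^{1/p}$ means that $\sum_{n=1}^\infty\big|\sum_{k=1}^n \frac{\lambda_k}{\Lambda_n}a_k\big|^p\le U\sum_{n=1}^\infty|a_n|^p$ for all $\mathbf{a}\in l^p$. *)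

(* Defs.v *)
From mathcomp Require Import all_boot all_order all_algebra.
From mathcomp Require Import all_classical all_reals all_analysis.
From mathcomp Require Export complex.

Set Implicit Arguments.
Unset Strict Implicit.
Unset Printing Implicit Defensive.

Import Order.TTheory GRing.Theory Num.Theory.
Import numFieldNormedType.Exports.

Local Open Scope classical_set_scope.
Local Open Scope ring_scope.
Local Open Scope complex_scope.

(* Index shift: position n : nat of a sequence, and of the rows and columns of
   an infinite matrix, stands for index n + 1 of the 1-based convention. *)

(* [Normc.normc] is the real-valued modulus; [`|z|] would live in [R[i]]. *)
Definition lpnorm (R : realType) (p : R) (a : nat -> R[i]) : \bar R :=
  ((\sum_(0 <= n <oo) (Normc.normc (a n) `^ p)%:E) `^ p^-1)%E.

Definition mx_summable (R : realType) (C : nat -> nat -> R[i])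
    (a : nat -> R[i]) : Prop :=
  forall n, cvgn (series (fun k => C n k * a k : R[i]^o)).

Definition mx_apply (R : realType) (C : nat -> nat -> R[i])
    (a : nat -> R[i]) : nat -> R[i] :=
  fun n => limn (series (fun k => C n k * a k : R[i]^o)).

(* [limn] is arbitrary on divergent series, so a matrix with a row that does
   not sum against some [a] of the unit ball is given norm [+oo]. *)
Definition lp_opnorm (R : realType) (p : R) (C : nat -> nat -> R[i]) : \bar R :=
  ereal_sup [set (if `[< mx_summable C a >] then lpnorm p (mx_apply C a)
                  else +oo%E) | a in [set a | (lpnorm p a <= 1)%E]].

Definition partial_weight (R : realType) (lambda : nat -> R) (n : nat) : R :=
  \sum_(i < n.+1) lambda i.

Definition weighted_mean_mx (R : realType) (lambda : nat -> R)
    (n k : nat) : R[i] :=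
  if (k <= n)%N then (lambda k / partial_weight lambda n)%:C else 0.

(* Main.v *)
(* Put c = L/p, r_n = Lambda_n / lambda_n, and let M_n be the weighted mean of
   |a_1|, ..., |a_n|, so that r_n M_n = |a_n| + (r_n - 1) M_(n-1).  Convexity of
   t^p, applied to r_n M_n / (r_n - c), which is a convex combination of
   |a_n| / (1 - c) and M_(n-1), gives
     (r_n - c) (r_n / (r_n - c))^p M_n^p
       <= (1 - c)^(1 - p) |a_n|^p + (r_n - 1) M_(n-1)^p.
   By (1 - t)^(1 - p) >= 1 + (p - 1) t + p (p - 1) t^2 / 2 at t = c / r_n, the
   hypothesis on lambda makes the coefficient on the left at least
   r_(n+1) - c = (1 - c) + (r_(n+1) - 1), and the inequalities telescope to
   (1 - c)^p sum M_n^p <= sum |a_n|^p. *)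
Require Import Defs.
From mathcomp Require Import all_boot all_order all_algebra.
From mathcomp Require Import all_classical all_reals all_analysis.
From mathcomp Require Import ring lra.

Import Order.TTheory GRing.Theory Num.Theory.
Import numFieldNormedType.Exports.

Local Open Scope ring_scope.

(** * Scalar inequalities for real powers *)

(** The quadratic is the second Taylor polynomial of [(1 - x) ^ (- e)] at 0, so in the derivative of
    the product all terms of order below [x ^+ 2] cancel. What remains, [g'], is nonpositive, and
    the product decreases from its value 1 at 0. *)
Lemma powR_taylor2_le (R : realType) (e x : R) :
  0 < e -> 0 <= x -> x < 1 ->
  (1 - x) `^ e * (1 + e * x + e * (e + 1) / 2 * x ^+ 2) <= 1.
Proof.
move=> e0 x0 x1.
pose g y : R := (1 - y) `^ e * (1 + e * y + e * (e + 1) / 2 * y ^+ 2).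
pose g' y : R := - (e * (e + 1) * (e + 2) / 2) * y ^+ 2 * (1 - y) `^ (e - 1).
have dg (y : R) : y < 1 -> is_derive y 1 g (g' y).
  move=> y1; have y1' : 0 < 1 - y by lra.
  have dpow : is_derive y 1 ((@powR R ^~ e) \o (fun z => 1 - z))
      (- (e * (1 - y) `^ (e - 1))).
    have d1 : is_derive y 1 (fun z : R => 1 - z) (- 1).
      by apply: is_derive_eq; rewrite add0r mul1r.
    have := @is_derive1_comp R (@powR R ^~ e) (fun z => 1 - z) y _ _
      (is_derive1_powR e y1') d1.
    by rewrite mulrN1.
  apply: is_derive_eq.
  rewrite /g'.
  (* Writing [(1 - y) ^ e] as [(1 - y) * (1 - y) ^ (e - 1)] leaves a single power [u], and the goal
     becomes a rational identity. *)
  rewrite -[X in X *: _]/((1 - y) `^ e) -(@mulr_powRB1 _ (1 - y) e); [|lra|lra].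
  rewrite /GRing.scale/=.
  set u := _ `^ _.
  by field.
have g0 : g 0 = 1 by rewrite /g subr0 powR1; ring.
suff: g x <= g 0 by rewrite g0.
apply: (@ler0_derive1_nincr R g 0 x) => // [y|y|].
- by rewrite in_itv/= => /andP[_ yx]; have [] := dg y (lt_trans yx x1).
- rewrite in_itv/= => /andP[y0 yx]; have dy := dg y (lt_trans yx x1).
  rewrite derive1E derive_val /g' !mulNr oppr_le0.
  by rewrite !mulr_ge0 ?powR_ge0//; lra.
- apply: derivable_within_continuous => y; rewrite in_itv/= => /andP[_ yx].
  by have [] := dg y (le_lt_trans yx x1).
Qed.

Lemma powRV (R : realType) (x p : R) : 0 <= x -> x^-1 `^ p = (x `^ p)^-1.
Proof. by move=> x0; rewrite -(powR_inv1 x0) -powRrM mulN1r powRN. Qed.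

Lemma weighted_powR_le (R : realType) (p s x y : R) :
  1 <= p -> 0 <= s -> s <= 1 -> 0 <= x -> 0 <= y ->
  (s * x + (1 - s) * y) `^ p <= s * x `^ p + (1 - s) * y `^ p.
Proof.
move=> p1 s0 s1 x0 y0.
have := @convex_powR R p p1 (Itv01 s0 s1) x y; rewrite !convRE /=; apply.
- by rewrite inE/= in_itv/= x0.
- by rewrite inE/= in_itv/= y0.
Qed.

Lemma weight_increment_le (R : realType) (p c r r' : R) :
  1 < p -> 0 < c -> c < 1 -> 1 <= r ->
  r' - r <= p * c + (2 * r)^-1 * (1 - 1 / p) * (p * c) ^+ 2 ->
  r' - c <= (r - c) * (r / (r - c)) `^ p.
Proof.
move=> p_gt1 c_gt0 c_lt1 r1 hr; have r0 : 0 < r by lra.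
have rc0 : 0 < r - c by lra.
have tE : 1 - c / r = (r - c) / r by field; rewrite gt_eqF.
have t0 : 0 < 1 - c / r by rewrite tE divr_gt0.
have := @powR_taylor2_le R (p - 1) (c / r).
set P := (_ + _ * (c / r) ^+ 2).
case/(_ _ _ _)/wrap=> [|||P1]; [lra|by rewrite divr_ge0//; lra|lra|].
have -> : r / (r - c) = (1 - c / r)^-1 by rewrite tE invf_div.
(* With [e = p - 1] and [t = c / r], [r * P] is exactly [r - c] plus the right side of the
   hypothesis; this is where the quadratic term of the bound comes from. *)
have rP : r' - c <= r * P.
  have -> : r * P = r - c + (p * c + (2 * r)^-1 * (1 - 1 / p) * (p * c) ^+ 2).
    by rewrite /P; field; apply/andP; split; rewrite gt_eqF//; lra.
  lra.
apply: (le_trans rP).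
have -> : r - c = r * (1 - c / r) by rewrite tE; field; rewrite gt_eqF.
rewrite -mulrA ler_pM2l//.
rewrite powRV ?(ltW t0)// ler_pdivlMr ?powR_gt0//.
rewrite -(@mulr_powRB1 _ _ p) ?(ltW t0)//; last lra.
by rewrite mulrCA -[leRHS]mulr1 ler_pM2l// mulrC.
Qed.

(** The coefficient [r' - c] is kept split: [(r' - 1) * m ^ p] is the last term on the right of the
    next step, which makes the sum telescope. *)
Lemma weighted_mean_step (R : realType) (p c r r' x y m : R) :
  1 < p -> 0 < c -> c < 1 -> 1 <= r -> 0 <= x -> 0 <= y ->
  r * m = x + (r - 1) * y ->
  r' - r <= p * c + (2 * r)^-1 * (1 - 1 / p) * (p * c) ^+ 2 ->
  (1 - c) * m `^ p + (r' - 1) * m `^ p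
    <= (1 - c) `^ (1 - p) * x `^ p + (r - 1) * y `^ p.
Proof.
move=> p_gt1 c_gt0 c_lt1 r1 x0 y0 mE hr; have r0 : 0 < r by lra.
have q0 : 0 < 1 - c by lra.
have rc0 : 0 < r - c by lra.
have m0 : 0 <= m by rewrite -(pmulr_rge0 _ r0) mE addr_ge0// mulr_ge0//; lra.
rewrite -mulrDl; have -> : 1 - c + (r' - 1) = r' - c by ring.
apply: le_trans (ler_wpM2r (powR_ge0 m p) (weight_increment_le _ _ _ _ _ p_gt1 c_gt0 c_lt1 r1 hr)) _.
rewrite -mulrA -powRM//; last by rewrite divr_ge0// ltW.
(* The weight [(1 - c) / (r - c)] is at most 1 because [1 <= r]. *)
have -> : r / (r - c) * m
    = (1 - c) / (r - c) * (x / (1 - c)) + (1 - (1 - c) / (r - c)) * y.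
  rewrite mulrAC mE; field.
  by rewrite !gt_eqF.
apply: le_trans
  (ler_wpM2l (ltW rc0) (@weighted_powR_le R p _ _ _ _ _ _ _ _)) _ => //.
- exact: ltW.
- by rewrite divr_ge0// ltW.
- by rewrite ler_pdivrMr// mul1r; lra.
- by rewrite divr_ge0// ltW.
rewrite mulrDr !mulrA.
have -> : (r - c) * (1 - c) / (r - c) = 1 - c by field; rewrite gt_eqF.
have -> : (r - c) * (1 - (1 - c) / (r - c)) = r - 1 by field; rewrite gt_eqF.
have q0' := ltW q0.
rewrite lerD2r powRM ?invr_ge0// mulrCA mulrC.
by rewrite powRV// powRB ?powRr1// (gt_eqF q0) implybT.
Qed.

(** * Weighted means of a nonnegative sequence *)

(* Indexed so that [weighted_mean lambda x 0 = 0 / 0 = 0]. *)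
Definition weighted_mean {R : realType} (lambda x : nat -> R) (n : nat) : R :=
  (\sum_(i < n) lambda i * x i) / \sum_(i < n) lambda i.

Lemma partial_weight_gt0 (R : realType) (lambda : nat -> R) (n : nat) :
  (forall m, 0 < lambda m) -> 0 < partial_weight lambda n.
Proof.
move=> l0.
by rewrite /partial_weight big_ord_recl ltr_pwDl// sumr_ge0// => i _; exact: ltW.
Qed.

Lemma weighted_mean_rec (R : realType) (lambda x : nat -> R) (n : nat) :
  (forall m, 0 < lambda m) ->
  let r := partial_weight lambda n / lambda n in
  r * weighted_mean lambda x n.+1 = x n + (r - 1) * weighted_mean lambda x n.
Proof.
move=> l0 /=; have ln := l0 n; have Wn := partial_weight_gt0 _ _ n l0.
rewrite /weighted_mean -/(partial_weight lambda n) big_ord_recr/=.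
have -> : partial_weight lambda n / lambda n - 1
    = (\sum_(i < n) lambda i) / lambda n.
  by rewrite /partial_weight big_ord_recr/= mulrDl divff ?gt_eqF// addrK.
(* At [n = 0] the denominator of the previous mean is the empty sum, so [field] cannot be used on
   it; there the term vanishes anyway. *)
case: n ln Wn => [|n] ln Wn.
  by rewrite !big_ord0 !mul0r addr0 add0r; field; rewrite !gt_eqF.
have W := partial_weight_gt0 _ _ n l0; rewrite -/(partial_weight lambda n).
by field; rewrite !gt_eqF.
Qed.

(** The boundary term in [weighted_mean lambda x N] is what the telescoping leaves over; it carries
    the induction on [N]. For [N = 0] its coefficient is [lambda 0 / lambda 0 - 1 = 0]. *)
Lemma sum_weighted_mean_powR_le (R : realType) (p L : R) (lambda x : nat -> R)
    (N : nat) :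
  1 < p -> 0 < L -> L < p ->
  (forall n, 0 < lambda n) -> (forall n, 0 <= x n) ->
  (forall n : nat,
     partial_weight lambda n.+1 / lambda n.+1
       - partial_weight lambda n / lambda n
     <= L + lambda n / (2 * partial_weight lambda n) * (1 - 1 / p) * L ^+ 2) ->
  (1 - L / p) * (\sum_(n < N) weighted_mean lambda x n.+1 `^ p)
    + (partial_weight lambda N / lambda N - 1) * weighted_mean lambda x N `^ p
  <= (1 - L / p) `^ (1 - p) * \sum_(n < N) x n `^ p.
Proof.
move=> p1 L0 Lp l0 x0 hL; have p0 : 0 < p by lra.
have mean0 n : 0 <= weighted_mean lambda x n.
  rewrite divr_ge0// sumr_ge0// => i _; last exact: ltW.
  by rewrite mulr_ge0// ltW.
elim: N => [|N IH].
  rewrite !big_ord0 /partial_weight big_ord_recl big_ord0 addr0 divff ?gt_eqF//.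
  by rewrite subrr mul0r !mulr0 addr0.
rewrite !big_ord_recr/= !mulrDr -addrA.
have lN := l0 N; have WN := partial_weight_gt0 _ _ N l0.
pose r n := partial_weight lambda n / lambda n.
suff : (1 - L / p) * weighted_mean lambda x N.+1 `^ p
    + (r N.+1 - 1) * weighted_mean lambda x N.+1 `^ p
    <= (1 - L / p) `^ (1 - p) * x N `^ p
    + (r N - 1) * weighted_mean lambda x N `^ p.
  by move: IH; rewrite /r; lra.
apply: weighted_mean_step => //.
- exact: divr_gt0.
- by rewrite ltr_pdivrMr// mul1r.
- rewrite ler_pdivlMr// mul1r /partial_weight big_ord_recr/= lerDr.
  by rewrite sumr_ge0// => i _; exact: ltW.
- exact: weighted_mean_rec.
- have -> : p * (L / p) = L by field; rewrite gt_eqF.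
  have -> : (2 * r N)^-1 = lambda N / (2 * partial_weight lambda N).
    by rewrite /r; field; rewrite !gt_eqF.
  exact: hL.
Qed.

(** * Passage to complex sequences, the matrix and the norms *)

Lemma normc_ge0 (R : rcfType) (z : R[i]%C) : 0 <= Normc.normc z.
Proof. by case: z => x y; exact: sqrtr_ge0. Qed.

Lemma normc_real (R : rcfType) (x : R) : Normc.normc (x%:C)%C = `|x|.
Proof. by rewrite /= expr0n addr0 sqrtr_sqr. Qed.

Lemma normc_sum_le (R : rcfType) (n : nat) (z : nat -> R[i]%C) :
  Normc.normc (\sum_(i < n) z i) <= \sum_(i < n) Normc.normc (z i).
Proof.
elim: n => [|n IH]; first by rewrite !big_ord0 Normc.normc0.
rewrite !big_ord_recr/=; apply: le_trans (le_normcD _ _) _.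
by rewrite lerD2r.
Qed.

(** Row [n] vanishes beyond the diagonal, so the partial sums are constant once [m > n]. *)
Lemma cvg_weighted_mean_mx_row (R : realType) (lambda : nat -> R)
    (a : nat -> R[i]%C) (n : nat) :
  (series (fun k => weighted_mean_mx lambda n k * a k : (R[i]%C)^o) @ \oo -->
    (\sum_(k < n.+1) weighted_mean_mx lambda n k * a k : (R[i]%C)^o))%classic.
Proof.
apply: cvg_near_cst; near=> m.
have nm : (n < m)%N by near: m; exact: nbhs_infty_gt.
rewrite /series/= (big_cat_nat (leq0n n.+1) nm)/= big_mkord.
rewrite [X in _ + X]big_nat_cond [X in _ + X]big1 ?addr0// => i /andP[/andP[ni _] _].
by rewrite /weighted_mean_mx leqNgt ni mul0r.
Unshelve. all: by end_near.
Qed.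

Lemma mx_apply_weighted_mean_mx (R : realType) (lambda : nat -> R)
    (a : nat -> R[i]%C) (n : nat) :
  mx_apply (weighted_mean_mx lambda) a n
    = \sum_(k < n.+1) weighted_mean_mx lambda n k * a k.
Proof. exact: (cvg_lim (@norm_hausdorff _ _) (cvg_weighted_mean_mx_row _ lambda a n)). Qed.

Lemma normc_mx_apply_le (R : realType) (lambda : nat -> R)
    (a : nat -> R[i]%C) (n : nat) : (forall m, 0 < lambda m) ->
  Normc.normc (mx_apply (weighted_mean_mx lambda) a n)
    <= weighted_mean lambda (fun k => Normc.normc (a k)) n.+1.
Proof.
move=> l0; rewrite mx_apply_weighted_mean_mx.
apply: le_trans (normc_sum_le _ _ (fun k => weighted_mean_mx lambda n k * a k)) _.
rewrite /weighted_mean mulr_suml; apply: ler_sum => k _.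
have kn : (k <= n)%N by rewrite -ltnS.
rewrite Normc.normcM /weighted_mean_mx kn normc_real ger0_norm.
  by rewrite mulrAC.
by rewrite divr_ge0 ?(ltW (l0 _))// ltW// partial_weight_gt0.
Qed.

(** Reduces the norm bound to partial sums of equal length, so that the finite telescoped inequality
    suffices. *)
Lemma lpnorm_mono (R : realType) (p C : R) (a b : nat -> R[i]%C) :
  0 < p -> 0 <= C ->
  (forall N, \sum_(n < N) Normc.normc (b n) `^ p
    <= C `^ p * \sum_(n < N) Normc.normc (a n) `^ p) ->
  (lpnorm p b <= C%:E * lpnorm p a)%E.
Proof.
move=> p0 C0 hab.
have pow_ge0 (c : nat -> R[i]%C) n : (0 <= (Normc.normc (c n) `^ p)%:E)%E.
  by rewrite lee_fin powR_ge0.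
have ser_ge0 (c : nat -> R[i]%C) :
    (0 <= \sum_(0 <= n <oo) (Normc.normc (c n) `^ p)%:E)%E.
  exact: nneseries_ge0.
have -> : (C%:E = (C `^ p)%:E `^ p^-1)%E.
  by rewrite poweR_EFin -powRrM mulfV ?gt_eqF// powRr1.
rewrite /lpnorm -poweRM//; last by rewrite lee_fin powR_ge0.
have le_ser : (\sum_(0 <= n <oo) (Normc.normc (b n) `^ p)%:E
    <= (C `^ p)%:E * \sum_(0 <= n <oo) (Normc.normc (a n) `^ p)%:E)%E.
  apply: lime_le; first exact: is_cvg_nneseries.
  apply: nearW => N.
  apply: (@le_trans _ _
      ((C `^ p)%:E * \sum_(0 <= n < N) (Normc.normc (a n) `^ p)%:E)%E).
    by rewrite !big_mkord !sumEFin -EFinM lee_fin.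
  by apply: lee_wpmul2l; [rewrite lee_fin powR_ge0 | exact: nneseries_lim_ge].
apply: gt0_ler_poweR => //; first by rewrite invr_ge0 ltW.
- by rewrite in_itv/= leey ser_ge0.
- by rewrite in_itv/= leey (le_trans (ser_ge0 b)).
Qed.

Theorem corollary1p1 (R : realType) (p : R) (lambda : nat -> R) (L : R)
    (p_gt1 : 1 < p)
    (lambda_gt0 : forall n : nat, 0 < lambda n)
    (L_gt0 : 0 < L) (L_ltp : L < p)
    (hL : forall n : nat,
       partial_weight lambda n.+1 / lambda n.+1
         - partial_weight lambda n / lambda n
       <= L + lambda n / (2 * partial_weight lambda n) * (1 - 1 / p) * L ^+ 2) :
  (lp_opnorm p (weighted_mean_mx lambda) <= (p / (p - L))%:E)%E.
Proof.
have p0 : 0 < p by lra.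
have pL : 0 < p - L by lra.
have q0 : 0 < 1 - L / p by rewrite subr_gt0 ltr_pdivrMr// mul1r.
have CE : p / (p - L) = (1 - L / p)^-1 by field; rewrite !gt_eqF.
apply: ge_ereal_sup => _ [a /= a1 <-].
(* Rules out the default value [+oo]. *)
have -> : `[< mx_summable (weighted_mean_mx lambda) a >].
  by apply/asboolP => n; apply: cvgP; exact: cvg_weighted_mean_mx_row.
apply: le_trans (_ : ((p / (p - L))%:E * lpnorm p a <= _)%E); last first.
  rewrite -[leRHS]mule1; apply: lee_wpmul2l => //.
  by rewrite lee_fin divr_ge0// ltW.
apply: lpnorm_mono => // [|N]; first by rewrite divr_ge0// ltW.
apply: (@le_trans _ _ (\sum_(n < N)
    weighted_mean lambda (fun k => Normc.normc (a k)) n.+1 `^ p)).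
  apply: ler_sum => n _; apply: ge0_ler_powR; first exact: ltW.
  - by rewrite nnegrE normc_ge0.
  - by rewrite nnegrE (le_trans (normc_ge0 _ _) (normc_mx_apply_le _ _ _ _ _)).
  - exact: normc_mx_apply_le.
have := @sum_weighted_mean_powR_le R p L lambda (fun k => Normc.normc (a k)) N
  p_gt1 L_gt0 L_ltp lambda_gt0 (fun k => normc_ge0 _ _) hL.
set S := (\sum_(n < N) weighted_mean _ _ _ `^ p) => hS.
(* The boundary term is nonnegative and is dropped. *)
have {}hS : (1 - L / p) * S
    <= (1 - L / p) `^ (1 - p) * \sum_(n < N) Normc.normc (a n) `^ p.
  apply: le_trans hS; rewrite lerDl mulr_ge0 ?powR_ge0// subr_ge0.
  rewrite ler_pdivlMr// mul1r /partial_weight big_ord_recr/= lerDr.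
  by rewrite sumr_ge0// => i _; exact: ltW.
(* The constants agree: with [q = 1 - L / p], [q * (q^-1) ^ p = q ^ (1 - p)]. *)
rewrite -(ler_pM2l q0); apply: le_trans hS _; rewrite mulrA.
rewrite CE powRV ?(ltW q0)// powRB ?powRr1 ?(ltW q0)//.
by rewrite (gt_eqF q0) implybT.
Qed.
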